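(* Let $m$ be a positive integer and let $R^m:\mathbb{S}\to\mathbb{S}$ be the $m$th power operator $R^m(x)=\{t_n^m\}_{n=1}^\infty$ for $x=\{t_n\}_{n=1}^\infty\in\mathbb{S}$. Then $R^m$ is Gâteaux differentiable on $\mathbb{S}$, and for every $\bar x=(\bar t_1,\bar t_2,\ldots)\in\mathbb{S}$ its Gâteaux derivative $(R^m)'(\bar x)$ at $\bar x$ satisfies the following. (i) If $m>1$, then $(R^m)'(\bar x)=\nabla(R^m)(\bar x)$ is the infinite diagonal matrix with diagonal entries $m\bar t_1^{\,m-1},m\bar t_2^{\,m-1},\ldots$, i.e. $(R^m)'(\bar x)(v)=\nabla(R^m)(\bar x)(v)=\{m\bar t_n^{\,m-1}s_n\}_{n=1}^\infty\in\mathbb{S}$ for every $v=\{s_n\}_{n=1}^\infty\in\mathbb{S}\setminus\{\theta_{\mathbb{S}}\}$. (ii) If $m=1$, then $R'(\bar x)=\nabla(R)(\bar x)$ (with $R=R^1$) is the infinite identity matrix, i.e. $R'(\bar x)(v)=v$ for every $v\in\mathbb{S}\setminus\{\theta_{\mathbb{S}}\}$.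
   Context: $\mathbb{S}$ is the real vector space of all sequences of real numbers, with origin $\theta_{\mathbb{S}}$. For $k=1,2,\ldots$ let $\|x\|_k=\frac{|t_k|}{1+|t_k|}$ for $x=\{t_n\}_{n=1}^\infty\in\mathbb{S}$. $\mathbb{S}$ carries the topology $\tau_{\mathbb{S}}$ induced by the family $\mathbb{F}_{\mathbb{S}}=\{\|\cdot\|_k:k=1,2,\ldots\}$, i.e. the sets $\{x:\max\{p(x-x_0):p\in I\}<\lambda\}$, with $I$ a nonempty finite subset of $\mathbb{F}_{\mathbb{S}}$ and $\lambda>0$, form a base of neighborhoods of $x_0$. $\mathcal{F}_{\mathbb{S}}$ is the collection of nonempty finite subsets of $\mathbb{F}_{\mathbb{S}}$. Gâteaux differentiability: $T:\mathbb{S}\to\mathbb{S}$ is Gâteaux differentiable at $\bar x$ with Gâteaux derivative $T'(\bar x)$ if for every $v\ne\theta_{\mathbb{S}}$ there is $T'(\bar x)(v)\in\mathbb{S}$ such that for every $J\in\mathcal{F}_{\mathbb{S}}$ and $\varepsilon>0$ there is $\delta>0$ such that, for real $t$, $0<|t|<\delta$ implies $\max\left\{q\left(\frac{T(\bar x+tv)-T(\bar x)-tT'(\bar x)(v)}{t}\right):q\in J\right\}<\varepsilon$. Fréchet derivative: $\nabla T(\bar x)=A$ is the assertion that $A:\mathbb{S}\to\mathbb{S}$ is a continuous linear mapping such that for every $J\in\mathcal{F}_{\mathbb{S}}$ and $\varepsilon>0$ there are $I\in\mathcal{F}_{\mathbb{S}}$ and $\delta>0$ such that for all $u\in\mathbb{S}$: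 if $\max\{p(u):p\in I\}=0$ then $\max\{q(T(\bar x+u)-T(\bar x)-A(u)):q\in J\}=0$; and if $0<\max\{p(u):p\in I\}<\delta$ then $\max\left\{q\left(\frac{T(\bar x+u)-T(\bar x)-A(u)}{\max\{p(u):p\in I\}}\right):q\in J\right\}<\varepsilon$. *)

(* Defs.v *)
From HB Require Import structures.
From mathcomp Require Import all_boot all_order all_algebra.
From mathcomp Require Import finmap all_classical all_reals all_analysis.
From mathcomp Require Import lra.
Set Implicit Arguments.
Unset Strict Implicit.
Unset Printing Implicit Defensive.
Import Order.TTheory GRing.Theory Num.Theory.
Import numFieldNormedType.Exports.
Local Open Scope classical_set_scope.
Local Open Scope ring_scope.

(* The terms of a sequence are numbered from 0: the term written t_k in the
   mathematical text, k >= 1, is [x k.-1], and the function written ||.||_k is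
   [snorm k.-1].  The type is an alias of [nat -> R] so that it can carry its
   own topology; its vector space structure is the pointwise one. *)
Definition seqS (R : realType) : Type := nat -> R.

HB.instance Definition _ (R : realType) :=
  GRing.Lmodule.copy (seqS R) (nat -> R^o).

Section Topology.
Context {R : realType}.
Implicit Types (I J : {fset (seqS R -> R)}) (x u v : seqS R).

Definition snorm (k : nat) (x : seqS R) : R := `|x k| / (1 + `|x k|).

Definition finsub I : Prop :=
  I != fset0 /\ {in I, forall p, exists k, p = snorm k}.

(* On members of [finsub] this is the maximum over I: the default value 0 is
   harmless since I is nonempty and its elements are nonnegative functions. *)
Definition maxnorm I (u : seqS R) : R := \big[Num.max/0]_(p <- I) p u.

Definition seqS_nbhs (x0 : seqS R) : set_system (seqS R) :=
  filter_from [set Il : {fset (seqS R -> R)} * R | finsub Il.1 /\ 0 < Il.2]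
    (fun Il => [set x | maxnorm Il.1 (x - x0) < Il.2]).

HB.instance Definition _ := hasNbhs.Build (seqS R) seqS_nbhs.

Lemma snorm0 k : snorm k 0 = 0.
Proof. by rewrite /snorm /= normr0 mul0r. Qed.

Lemma snormD k u v : snorm k (u + v) <= snorm k u + snorm k v.
Proof.
have fE (a : R) : 0 <= a -> a / (1 + a) = 1 - (1 + a)^-1.
  move=> a0; have h : 1 + a != 0 by rewrite gt_eqF// ltr_wpDr.
  by apply: (mulIf h); rewrite mulfVK// mulrBl mul1r mulVf// addrAC subrr add0r.
have f_ge0 (a : R) : 0 <= a -> 0 <= a / (1 + a).
  by move=> a0; rewrite divr_ge0// addr_ge0.
rewrite /snorm; have -> : (u + v) k = u k + v k by [].
set a := `|u k|; set b := `|v k|; set c := `|u k + v k|.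
have [a0 b0 c0] : [/\ 0 <= a, 0 <= b & 0 <= c] by split; apply: normr_ge0.
have cab : c <= a + b by exact: ler_normD.
have d0 : 0 < 1 + (a + b) by lra.
apply: (@le_trans _ _ ((a + b) / (1 + (a + b)))).
  rewrite !fE ?addr_ge0// lerD2l lerN2 lef_pV2 ?posrE//; lra.
rewrite mulrDl lerD//.
  by apply: ler_wpM2l => //; rewrite lef_pV2 ?posrE//; lra.
by apply: ler_wpM2l => //; rewrite lef_pV2 ?posrE//; lra.
Qed.

Lemma maxnorm_ltP I u (l : R) : 0 < l ->
  maxnorm I u < l <-> {in I, forall p, p u < l}.
Proof.
move=> l0; split=> [h p pI|h].
  apply: le_lt_trans h; rewrite /maxnorm.
  exact: (@le_bigmax_seq _ _ _ _ 0 p xpredT (fun q => q u)).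
by rewrite /maxnorm big_seq; apply: bigmax_lt.
Qed.

Lemma maxnorm0 I : finsub I -> maxnorm I 0 = 0.
Proof.
move=> [_ hI]; rewrite /maxnorm big_seq.
apply: (big_ind (fun a => a = 0)) => // [a b -> ->|p /hI [k ->]].
  exact: maxxx.
exact: snorm0.
Qed.

Lemma finsub1 k : finsub [fset snorm k]%fset.
Proof.
split; first by apply/fset0Pn; exists (snorm k); rewrite inE.
by move=> p; rewrite inE => /eqP ->; exists k.
Qed.

Lemma seqS_nbhs_filter x : ProperFilter (nbhs x).
Proof.
apply: filter_from_proper; last first.
  by move=> [I l] [/= hI l0]; exists x; rewrite /= subrr maxnorm0.
apply: filter_from_filter.
  exists ([fset snorm 0%N]%fset, 1); split=> //=; exact: finsub1.
move=> [I l] [J e] [/= hI l0] [/= hJ e0].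
have le0 : 0 < Num.min l e by rewrite lt_min l0.
exists (I `|` J, Num.min l e)%fset.
  split=> //=; split.
    case: hI => /fset0Pn [p pI] _; apply/fset0Pn.
    by exists p; rewrite inE pI.
  by move=> p; rewrite inE => /orP[]; [apply: hI.2|apply: hJ.2].
move=> y /= /(maxnorm_ltP _ _ le0) h; split; apply/maxnorm_ltP => // p pI.
  have : p (y - x) < Num.min l e by apply: h; rewrite inE pI.
  by rewrite lt_min => /andP[].
have : p (y - x) < Num.min l e by apply: h; rewrite inE pI orbT.
by rewrite lt_min => /andP[].
Qed.

Lemma seqS_nbhs_singleton x (A : set (seqS R)) : nbhs x A -> A x.
Proof. by move=> [[I l] [/= hI l0]]; apply; rewrite /= subrr maxnorm0. Qed.

Lemma seqS_nbhs_nbhs x (A : set (seqS R)) : nbhs x A -> nbhs x (nbhs^~ A).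
Proof.
move=> [[I l] [/= hI l0] hA].
have l20 : 0 < l / 2 by rewrite divr_gt0.
exists (I, l / 2) => //= y /= /(maxnorm_ltP _ _ l20) hy.
exists (I, l / 2) => //= z /= /(maxnorm_ltP _ _ l20) hz.
apply: hA => /=; apply/maxnorm_ltP => // p pI.
have -> : z - x = (z - y) + (y - x) by rewrite addrA subrK.
have [k pk] := hI.2 p pI; have := hz p pI; have := hy p pI; rewrite pk.
have := snormD k (z - y) (y - x); lra.
Qed.

HB.instance Definition _ := Nbhs_isNbhsTopological.Build (seqS R)
  seqS_nbhs_filter seqS_nbhs_singleton seqS_nbhs_nbhs.

End Topology.

Section Differentiability.
Context {R : realType}.
Implicit Types (T D A : seqS R -> seqS R) (x : seqS R).

(* The value of D at the origin is left unconstrained. *)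
Definition is_gateaux_derivative T x D : Prop :=
  forall v : seqS R, v <> 0 ->
  forall J, finsub J -> forall e : R, 0 < e ->
  exists2 d : R, 0 < d &
    forall t : R, 0 < `|t| < d ->
      maxnorm J (t^-1 *: (T (x + t *: v) - T x - t *: D v)) < e.

Definition gateaux_differentiable T x : Prop :=
  exists D, is_gateaux_derivative T x D.

Definition is_frechet_derivative T x A : Prop :=
  [/\ linear A, continuous A &
    forall J, finsub J -> forall e : R, 0 < e ->
    exists I (d : R), [/\ finsub I, 0 < d &
      forall u : seqS R,
        (maxnorm I u = 0 -> maxnorm J (T (x + u) - T x - A u) = 0) /\
        (0 < maxnorm I u < d ->
          maxnorm J ((maxnorm I u)^-1 *: (T (x + u) - T x - A u)) < e)]].

Definition power_op (m : nat) (x : seqS R) : seqS R := fun n => x n ^+ m.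

(* The action of the infinite diagonal matrix with diagonal entries d n. *)
Definition diag_op (d : nat -> R) (v : seqS R) : seqS R := fun n => d n * v n.

End Differentiability.

(* Main.v *)
Require Import Defs.
From mathcomp Require Import all_boot all_order all_algebra.
From mathcomp Require Import finmap all_classical all_reals all_analysis.
From mathcomp Require Import ring lra.
Import Order.TTheory GRing.Theory Num.Theory.
Import numFieldNormedType.Exports.
Local Open Scope ring_scope.

(** The functional snorm k is comparable to |x k| near 0, namely
    snorm k x <= |x k| always and |x k| <= 2 snorm k x once snorm k x <= 1/2, so
    each finite set of seminorm-like functions can be handled coordinatewise
    with absolute values.  The Taylor remainder of t |-> t^m is quadratic, hence
    diag_op (m t^(m-1)) is a Frechet derivative (with I = J) and a Gateaux
    derivative.  Gateaux derivatives are unique off the origin, being coordinatewise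
    limits of difference quotients.  Frechet derivatives are limits of difference
    quotients along bounded directions, and continuity extends their uniqueness to
    all directions. *)

(** * Comparison of [snorm] and [maxnorm] with coordinatewise absolute values *)

Section Snorm.
Context {R : realType}.
Implicit Types (I J : {fset (seqS R -> R)}) (u v : seqS R).

Lemma snorm_ge0 k u : 0 <= snorm k u.
Proof. by rewrite /snorm divr_ge0 ?addr_ge0. Qed.

Lemma snorm_le_norm k u : snorm k u <= `|u k|.
Proof.
rewrite /snorm ler_pdivrMr; last by rewrite ltr_wpDr.
by rewrite ler_peMr// lerDl.
Qed.

(** The hypothesis forces [|u k| <= 1], so the denominator [1 + |u k|] is at most 2. *)
Lemma norm_le_snorm k u : snorm k u <= 2^-1 -> `|u k| <= 2 * snorm k u.
Proof.
have h0 : 0 < 1 + `|u k| by rewrite ltr_wpDr.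
rewrite /snorm ler_pdivrMr// => h.
rewrite mulrA ler_pdivlMr// mulrC ler_wpM2r//; lra.
Qed.

Lemma snorm_eq0 k u : snorm k u = 0 -> u k = 0.
Proof.
move=> h; apply/eqP; rewrite -normr_le0.
by apply: le_trans (norm_le_snorm k u _) _; rewrite h ?mulr0// invr_ge0.
Qed.

Lemma le_maxnorm I p u : p \in I -> p u <= maxnorm I u.
Proof.
move=> pI; rewrite /maxnorm.
exact: (@le_bigmax_seq _ _ _ _ 0 p xpredT (fun q => q u)).
Qed.

Lemma maxnorm_ge0 I u : 0 <= maxnorm I u.
Proof. by rewrite /maxnorm; exact: bigmax_ge_id. Qed.

Lemma maxnorm_le I u (c : R) : 0 <= c ->
  {in I, forall p, p u <= c} -> maxnorm I u <= c.
Proof. by move=> c0 h; rewrite /maxnorm big_seq; apply: bigmax_le. Qed.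

(** The indicator sequence of k separates [snorm k] from every other [snorm j]. *)
Lemma snorm_inj : injective (@snorm R).
Proof.
move=> j k jk; apply/eqP/negP => /negP njk.
pose u : seqS R := fun n => (n == k)%:R.
have : snorm k u = 0 by rewrite -jk /snorm /u (negbTE njk) normr0 mul0r.
by move=> /snorm_eq0; rewrite /u eqxx => /eqP; rewrite oner_eq0.
Qed.

Lemma finsub_bound I (d : nat -> R) :
  exists2 C : R, 0 < C & forall k, snorm k \in I -> `|d k| <= C.
Proof.
(* I contains functions, not indices; injectivity of [snorm] makes [idx] recover k from [snorm k].
   Starting the maximum at 1 keeps the bound positive. *)
pose idx (p : seqS R -> R) : nat := xget 0%N [set k | p = snorm k].
exists (\big[Num.max/1]_(p <- I) `|d (idx p)|).
  by apply: (lt_le_trans ltr01); exact: bigmax_ge_id.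
move=> k kI; have <- : idx (snorm k) = k.
  by apply: xget_unique => // j /snorm_inj.
exact: (@le_bigmax_seq _ _ _ _ 1 (snorm k) xpredT (fun p => `|d (idx p)|)).
Qed.

Lemma maxnorm_lt J u (e : R) : finsub J -> 0 < e ->
  (forall k, snorm k \in J -> `|u k| < e) -> maxnorm J u < e.
Proof.
move=> [_ hJ] e0 h; apply/maxnorm_ltP => // p pJ.
have [k pk] := hJ p pJ; rewrite pk in pJ *.
exact: le_lt_trans (snorm_le_norm k u) (h k pJ).
Qed.

Lemma norm_le_maxnorm J u k : snorm k \in J ->
  maxnorm J u <= 2^-1 -> `|u k| <= 2 * maxnorm J u.
Proof.
move=> kJ h; have hk := le_maxnorm _ _ u kJ.
apply: le_trans (norm_le_snorm _ _ (le_trans hk h)) _.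
by rewrite ler_wpM2l.
Qed.

Lemma maxnorm_eq0 J u : finsub J ->
  maxnorm J u = 0 <-> forall k, snorm k \in J -> u k = 0.
Proof.
move=> [_ hJ]; split=> [h k kJ|h].
  apply: snorm_eq0; apply/eqP; rewrite eq_le snorm_ge0 andbT -h.
  exact: le_maxnorm.
rewrite /maxnorm big_seq; apply: (big_ind (fun a : R => a = 0)) => //.
  by move=> a b -> ->; exact: maxxx.
move=> p pJ; have [k pk] := hJ p pJ; rewrite pk in pJ *.
by rewrite /snorm h// normr0 mul0r.
Qed.

End Snorm.

(** * Uniqueness of Gateaux and Frechet derivatives *)

Section Derivatives.
Local Open Scope classical_set_scope.
Context {R : realType}.
Implicit Types (T A D : seqS R -> seqS R) (x v : seqS R).

Definition quotient T x v n (t : R) : R := t^-1 * (T (x + t *: v) n - T x n).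

(** A limit from the right already determines the derivative, and [t > 0] avoids sign cases. *)
Lemma quotient_cvg T x v n (a : R) :
  (forall e, 0 < e -> exists2 d, 0 < d & forall t, 0 < t < d ->
     `|t^-1 * (T (x + t *: v) n - T x n - t * a)| < e) ->
  quotient T x v n t @[t --> 0^'+] --> a.
Proof.
move=> h; apply/cvgrPdist_lt => e /h[d d0 {}h].
near=> t.
have t0 : 0 < t by near: t; exact: nbhs_right_gt.
have td : t < d by near: t; exact: nbhs_right_lt.
rewrite distrC /quotient.
have -> : t^-1 * (T (x + t *: v) n - T x n) - a =
    t^-1 * (T (x + t *: v) n - T x n - t * a) by field; rewrite gt_eqF.
by apply: h; rewrite t0.
Unshelve. all: by end_near. Qed.

Lemma gateaux_cvg T x D v n : is_gateaux_derivative T x D -> v <> 0 ->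
  quotient T x v n t @[t --> 0^'+] --> D v n.
Proof.
move=> hD v0; apply: quotient_cvg => e e0.
(* The bound 1/2 makes [norm_le_maxnorm] applicable; [e / 2] absorbs its factor 2. *)
pose e' := Num.min 2^-1 (e / 2).
have e'0 : 0 < e' by rewrite lt_min; apply/andP; split; lra.
have [e'2 e'e] : e' <= 2^-1 /\ e' <= e / 2 by rewrite /e' !ge_min !lexx orbT.
have [d d0 hd] := hD v v0 _ (finsub1 n) e' e'0.
exists d => // t /andP[t0 td].
have {hd} := hd t; rewrite gtr0_norm// t0 td => /(_ isT) hd.
have nS : snorm n \in [fset (@snorm R n)]%fset by rewrite inE.
have := norm_le_maxnorm _ _ n nS (ltW (lt_le_trans hd e'2)).
set w := `|_|; have -> : w = `|t^-1 * (T (x + t *: v) n - T x n - t * D v n)| by [].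
by move=> h; lra.
Qed.

Lemma gateaux_unique T x D D' v : is_gateaux_derivative T x D ->
  is_gateaux_derivative T x D' -> v <> 0 -> D v = D' v.
Proof.
move=> hD hD' v0; apply/funext => n.
exact: cvg_unique (gateaux_cvg _ _ _ _ n hD v0) (gateaux_cvg _ _ _ _ n hD' v0).
Qed.

Lemma linear_op0 A : linear A -> A 0 = 0.
Proof.
by move=> linA; have := linA (-1) 0 0; rewrite scaler0 addr0 scaleN1r addNr.
Qed.

(* Boundedness of v is essential: the set I given by Frechet differentiability
   may grow as the accuracy e shrinks, and max_I of snorm k (t v) has to stay
   O(t) uniformly in I. *)
Lemma frechet_cvg T x A v (C : R) n : is_frechet_derivative T x A ->
  (forall k, `|v k| <= C) -> quotient T x v n t @[t --> 0^'+] --> A v n.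
Proof.
move=> [linA _ hA] vC; apply: quotient_cvg => e e0.
have AZ t : A (t *: v) n = t * A v n.
  by have := linA t v 0; rewrite !addr0 linear_op0// addr0 => ->.
have C0 : 0 < C + 1 by have := le_trans (normr_ge0 _) (vC 0%N); lra.
(* The definition divides by M, the quotient by t; since [M <= t * (C + 1)], the change of divisor
   costs a factor [C + 1], which is positive even when C is 0. *)
pose e' := Num.min 2^-1 (e / (C + 1) / 2).
have eC0 : 0 < e / (C + 1) by rewrite divr_gt0.
have e'0 : 0 < e' by rewrite lt_min; apply/andP; split; lra.
have [e'2 e'e] : e' <= 2^-1 /\ e' <= e / (C + 1) / 2.
  by rewrite /e' !ge_min !lexx orbT.
have [I [d [hI d0 hd]]] := hA _ (finsub1 n) e' e'0.
exists (d / (C + 1)); first by rewrite divr_gt0.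
move=> t /andP[t0]; rewrite ltr_pdivlMr// => td.
have nS : snorm n \in [fset (@snorm R n)]%fset by rewrite inE.
have [hd1 hd2] := hd (t *: v).
pose rem := T (x + t *: v) - T x - A (t *: v).
have remE : rem n = T (x + t *: v) n - T x n - t * A v n by rewrite -AZ.
rewrite -remE.
set M := maxnorm I (t *: v) in hd1 hd2.
have Mt : M <= t * (C + 1).
  apply: maxnorm_le; first by rewrite mulr_ge0// ltW.
  move=> p pI; have [k ->] := hI.2 p pI.
  apply: le_trans (snorm_le_norm k _) _.
  have -> : (t *: v) k = t * v k by [].
  rewrite normrM gtr0_norm// ler_wpM2l ?ltW//.
  by have := vC k; lra.
(* Division by M is meaningless when M is 0; there the first clause of the definition makes the
   remainder vanish. *)
have [M0|M0] := eqVneq M 0.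
  have := hd1 M0; rewrite maxnorm_eq0; last exact: finsub1.
  by move=> /(_ n nS); rewrite -/rem => ->; rewrite mulr0 normr0.
have {M0} M0 : 0 < M by rewrite lt_def M0 maxnorm_ge0.
have {hd1 hd2} h : maxnorm [fset (@snorm R n)]%fset (M^-1 *: rem) < e'.
  by apply: hd2; rewrite M0 (le_lt_trans Mt).
have := norm_le_maxnorm _ _ n nS (ltW (lt_le_trans h e'2)).
have -> : (M^-1 *: rem) n = M^-1 * rem n by [].
rewrite !normrM !normfV (gtr0_norm M0) (gtr0_norm t0) => h1.
have {}h1 : M^-1 * `|rem n| < e / (C + 1) by lra.
rewrite mulrC ltr_pdivrMr//; rewrite mulrC ltr_pdivrMr// in h1.
apply: (lt_le_trans h1).
by rewrite mulrAC ler_pdivrMr// -mulrA ler_pM2l.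
Qed.

(* Both derivatives agree on finitely supported, hence bounded, sequences, and
   continuity makes coordinate n of A v depend, up to any given accuracy, only
   on finitely many coordinates of v. *)
Lemma frechet_unique T x A A' : is_frechet_derivative T x A ->
  is_frechet_derivative T x A' -> A = A'.
Proof.
move=> hA hA'; apply/funext => v; apply/funext => n.
have approx (B : seqS R -> seqS R) (e : R) : continuous B -> 0 < e ->
    exists I : {fset (seqS R -> R)}, forall y : seqS R, (forall k, snorm k \in I -> y k = v k) ->
      `|B y n - B v n| < e.
  move=> cB e0.
  pose e' := Num.min 2^-1 (e / 3).
  have e'0 : 0 < e' by rewrite lt_min; apply/andP; split; lra.
  have [e'2 e'e] : e' <= 2^-1 /\ e' <= e / 3 by rewrite /e' !ge_min !lexx orbT.
  have : nbhs (B v) [set z | maxnorm [fset (@snorm R n)]%fset (z - B v) < e'].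
    by exists ([fset (@snorm R n)]%fset, e') => //; split => //; exact: finsub1.
  move=> /(cB v) [[I l] [/= hI l0] hIl]; exists I => y yv.
  have /= h : maxnorm [fset (@snorm R n)]%fset (B y - B v) < e'.
    (* Agreement with v on the coordinates of I puts y in every I-ball around v, whatever its
       radius. *)
    apply: hIl => /=; have -> // : maxnorm I (y - v) = 0.
    rewrite maxnorm_eq0// => k /yv yvk.
    by have -> : (y - v) k = y k - v k by []; rewrite yvk subrr.
  have nS : snorm n \in [fset (@snorm R n)]%fset by rewrite inE.
  have := norm_le_maxnorm _ _ n nS (ltW (lt_le_trans h e'2)).
  have -> : (B y - B v) n = B y n - B v n by [].
  by move=> h'; lra.
apply/eqP/negP => /negP ne.
pose g := `|A v n - A' v n|.
have g0 : 0 < g / 2 by rewrite divr_gt0// normr_gt0 subr_eq0.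
have [_ cA _] := hA; have [_ cA' _] := hA'.
have [I hI] := approx A _ cA g0; have [I' hI'] := approx A' _ cA' g0.
pose K := (I `|` I')%fset.
have [C C0 hC] := finsub_bound K v.
(* Truncating v to the coordinates of K gives a bounded direction, on which A and A' agree; each is
   within g / 2 of its value at v, contradicting a gap of g. *)
pose y : seqS R := fun k => if snorm k \in K then v k else 0.
have yC k : `|y k| <= C.
  by rewrite /y; case: ifPn => [/hC//|_]; rewrite normr0 ltW.
have yA : A y n = A' y n.
  exact: cvg_unique (frechet_cvg _ _ _ _ _ n hA yC)
    (frechet_cvg _ _ _ _ _ n hA' yC).
have {}hI : `|A y n - A v n| < g / 2.
  by apply: hI => k kI; rewrite /y inE kI.
have {}hI' : `|A' y n - A' v n| < g / 2.
  by apply: hI' => k kI; rewrite /y inE kI orbT.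
have : g <= `|A' y n - A' v n| + `|A y n - A v n|.
  rewrite /g; have -> : A v n - A' v n = (A' y n - A' v n) - (A y n - A v n).
    by rewrite yA; ring.
  exact: ler_normB.
by lra.
Qed.

End Derivatives.

(** * Derivatives of the power operator *)

Section Power.
Context {R : realType}.
Implicit Types (x v u : seqS R).

(** Induction on m: the next remainder is [(a + s)] times the previous one plus [m * a^(m-1) * s^2],
    and [|a + s| <= |a| + 1]. *)
Lemma power_remainder m (a : R) : exists2 C : R, 0 < C & forall s, `|s| <= 1 ->
  `|(a + s) ^+ m - a ^+ m - m%:R * a ^+ m.-1 * s| <= C * `|s| ^+ 2.
Proof.
elim: m => [|m [C C0 IH]].
  by exists 1 => // s _; rewrite !expr0 subrr !mul0r subr0 normr0 mul1r exprn_ge0.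
exists ((`|a| + 1) * C + `|m%:R * a ^+ m.-1|).
  by rewrite ltr_wpDr// mulr_gt0// ltr_wpDl.
move=> s s1; have {IH} := IH s s1; set r := _ - _ * s => hr.
(* At m = 0 the exponent [m.-1] is truncated, but the factor [m%:R] makes both sides vanish. *)
have aE : m%:R * a ^+ m = a * (m%:R * a ^+ m.-1).
  by case: (m) => [|j]; rewrite ?mul0r ?mulr0//= exprS; ring.
have -> : (a + s) ^+ m.+1 - a ^+ m.+1 - m.+1%:R * a ^+ m.+1.-1 * s =
    (a + s) * r + m%:R * a ^+ m.-1 * s ^+ 2.
  rewrite /r !exprS /= -natr1 (mulrDl m%:R) aE; ring.
apply: le_trans (ler_normD _ _) _; rewrite !normrM mulrDl normrX lerD//.
rewrite -mulrA ler_pM//.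
by apply: le_trans (ler_normD _ _) _; rewrite lerD2l.
Qed.

Definition power_derivative m x := diag_op (fun n => m%:R * x n ^+ m.-1).

Lemma power_op_remainder m x : exists C : nat -> R, forall k u, `|u k| <= 1 ->
  `|(power_op m (x + u) - power_op m x - power_derivative m x u) k| <=
    C k * `|u k| ^+ 2.
Proof.
have /choice[C hC] : forall k, exists C : R, forall s, `|s| <= 1 ->
  `|(x k + s) ^+ m - x k ^+ m - m%:R * x k ^+ m.-1 * s| <= C * `|s| ^+ 2.
  by move=> k; have [C _ h] := power_remainder m (x k); exists C.
by exists C => k u; exact: hC.
Qed.

Lemma diag_op_linear (d : nat -> R) : linear (diag_op d).
Proof.
move=> a u v; apply/funext => n.
have -> : (a *: diag_op d u + diag_op d v) n = a * (d n * u n) + d n * v n by [].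
have -> : diag_op d (a *: u + v) n = d n * (a * u n + v n) by [].
by ring.
Qed.

(** Output coordinate k depends only on input coordinate k, so the same J serves on both sides, with
    d bounded on it. *)
Lemma diag_op_continuous (d : nat -> R) : continuous (diag_op d).
Proof.
move=> x B [[J e] [/= hJ e0] hB].
have [C C0 hC] := finsub_bound J d.
pose l := Num.min 2^-1 (e / C / 2).
have eC0 : 0 < e / C by rewrite divr_gt0.
have l0 : 0 < l by rewrite lt_min; apply/andP; split; lra.
have [l2 le] : l <= 2^-1 /\ l <= e / C / 2 by rewrite /l !ge_min !lexx orbT.
exists (J, l) => //= y /= hy; apply: hB => /=.
apply: maxnorm_lt => // k kJ.
have := norm_le_maxnorm _ _ k kJ (ltW (lt_le_trans hy l2)).
have -> : (y - x) k = y k - x k by [].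
have -> : (diag_op d y - diag_op d x) k = d k * (y k - x k).
  by rewrite mulrBr.
move=> h; rewrite normrM.
have h' : `|y k - x k| < e / C by lra.
rewrite ltr_pdivlMr// mulrC in h'; apply: le_lt_trans h'.
by rewrite ler_wpM2r// hC.
Qed.

Lemma power_frechet m x :
  is_frechet_derivative (power_op m) x (power_derivative m x).
Proof.
split; [exact: diag_op_linear|exact: diag_op_continuous|].
move=> J hJ e e0; have [C0 hC0] := power_op_remainder m x.
have [C Cpos hC] := finsub_bound J C0.
have eC0 : 0 < e / C by rewrite divr_gt0.
(* On J the remainder is at most [C * (2 * M)^2]; divided by M this is [4 * C * M], hence the radius
   [e / C / 4]. *)
exists J, (Num.min 2^-1 (e / C / 4)); split=> //.
  by rewrite lt_min; apply/andP; split; lra.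
move=> u; set M := maxnorm J u; set r := _ - _ - _.
have rC k : snorm k \in J -> M <= 2^-1 -> `|r k| <= C * (2 * M) ^+ 2.
  move=> kJ M2; have h := norm_le_maxnorm _ _ k kJ M2; rewrite -/M in h.
  have u1 : `|u k| <= 1 by lra.
  apply: le_trans (hC0 k u u1) _.
  apply: (@le_trans _ _ (C * `|u k| ^+ 2)).
    by rewrite ler_wpM2r ?exprn_ge0// (le_trans (ler_norm _))// hC.
  by rewrite ler_pM2l// lerXn2r ?nnegrE// mulr_ge0// maxnorm_ge0.
split=> [M0|/andP[M0]].
  apply/maxnorm_eq0 => // k kJ; apply/eqP; rewrite -normr_le0.
  by apply: le_trans (rC k kJ _) _; rewrite M0 ?mulr0 ?expr0n ?mulr0// invr_ge0.
rewrite lt_min => /andP[M2]; rewrite ltr_pdivlMr// ltr_pdivlMr// => Me.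
apply: maxnorm_lt => // k kJ.
have -> : (M^-1 *: r) k = M^-1 * r k by [].
rewrite normrM gtr0_norm ?invr_gt0// mulrC ltr_pdivrMr//.
apply: le_lt_trans (rC k kJ (ltW M2)) _.
have -> : C * (2 * M) ^+ 2 = (M * 4 * C) * M by ring.
by rewrite ltr_pM2r.
Qed.

Lemma power_gateaux m x :
  is_gateaux_derivative (power_op m) x (power_derivative m x).
Proof.
move=> v _ J hJ e e0; have [C0 hC0] := power_op_remainder m x.
have [V V0 hV] := finsub_bound J v.
have [C Cpos hC] := finsub_bound J C0.
have CV0 : 0 < C * V ^+ 2 by rewrite mulr_gt0// exprn_gt0.
(* The first bound gives [|t * v k| <= 1], as the remainder estimate requires; the second makes the
   quotient bound [C * V^2 * |t|] smaller than e. *)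
exists (Num.min V^-1 (e / (C * V ^+ 2))).
  by rewrite lt_min invr_gt0 V0 divr_gt0.
move=> t /andP[t0]; rewrite lt_min => /andP[tV te].
rewrite ltr_pdivlMr// in te.
apply: maxnorm_lt => // k kJ.
have tv : `|(t *: v) k| <= `|t| * V.
  have -> : (t *: v) k = t * v k by [].
  by rewrite normrM ler_wpM2l// hV.
have tv1 : `|(t *: v) k| <= 1.
  by apply: (le_trans tv); rewrite -ler_pdivlMr// div1r ltW.
have := hC0 k _ tv1; set r := `|_| => hr.
(* Moving t inside the linear term turns w into the remainder at [t *: v], divided by t. *)
set w := (_ *: _).
have -> : w k = t^-1 * (power_op m (x + t *: v) - power_op m x
    - power_derivative m x (t *: v)) k.
  have -> : w k = t^-1 * (power_op m (x + t *: v) k - power_op m x k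
    - t * power_derivative m x v k) by [].
  congr (_ * (_ - _)); rewrite /power_derivative /diag_op.
  by have -> : (t *: v) k = t * v k by []; rewrite mulrCA.
rewrite normrM normfV mulrC ltr_pdivrMr// -/r.
apply: le_lt_trans hr _.
apply: (@le_lt_trans _ _ (C * (`|t| * V) ^+ 2)).
  apply: (@le_trans _ _ (C * `|(t *: v) k| ^+ 2)).
    by rewrite ler_wpM2r ?exprn_ge0// (le_trans (ler_norm _))// hC.
  by rewrite ler_pM2l// lerXn2r ?nnegrE// mulr_ge0// ltW.
have -> : C * (`|t| * V) ^+ 2 = (`|t| * (C * V ^+ 2)) * `|t| by ring.
by rewrite ltr_pM2r.
Qed.

End Power.

Theorem theorem7p3 (R : realType) (m : nat) (hm : (0 < m)%N) :
  (forall x : seqS R, gateaux_differentiable (power_op m) x) /\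
  (forall (x : seqS R) (D : seqS R -> seqS R),
     is_gateaux_derivative (power_op m) x D ->
     ((1 < m)%N ->
        (exists A : seqS R -> seqS R, is_frechet_derivative (power_op m) x A) /\
        (forall A : seqS R -> seqS R, is_frechet_derivative (power_op m) x A ->
         forall v : seqS R, v <> 0 ->
           D v = A v /\ A v = diag_op (fun n => m%:R * x n ^+ m.-1) v)) /\
     (m = 1%N ->
        (exists A : seqS R -> seqS R, is_frechet_derivative (power_op m) x A) /\
        (forall A : seqS R -> seqS R, is_frechet_derivative (power_op m) x A ->
         forall v : seqS R, v <> 0 -> D v = A v /\ A v = v))).
Proof.
split=> [x|x D hD]; first by exists (power_derivative m x); exact: power_gateaux.
have ex : exists A, is_frechet_derivative (power_op m) x A.
  by exists (power_derivative m x); exact: power_frechet.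
(* Both uniqueness results reduce A and D to the explicit diagonal operator. *)
have val A : is_frechet_derivative (power_op m) x A -> forall v, v <> 0 ->
    D v = A v /\ A v = power_derivative m x v.
  move=> hA v v0; rewrite (frechet_unique _ _ _ _ hA (power_frechet m x)).
  by split=> //; exact: gateaux_unique hD (power_gateaux m x) v0.
split=> [_|m1]; split=> // A hA v v0.
have [-> ->] := val A hA v v0; rewrite m1.
(* For m = 1 the diagonal entries are [x n ^+ 0], equal to 1 even where [x n] is 0. *)
suff -> : power_derivative 1 x v = v by [].
by apply/funext => n; rewrite /power_derivative /diag_op expr0 !mul1r.
Qed.
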